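(* Every piecewise-linear function $\varphi:\mathbb{R}^d\to\mathbb{R}$ is a (finite, real) linear combination of conewise linear functions $\mathbb{R}^d\to\mathbb{R}$, where distinct conewise linear functions in the combination may have their cones originate from distinct points.
   Context: A piecewise-linear function is a continuous function $\mathbb{R}^d\to\mathbb{R}$ for which there is a finite cover of $\mathbb{R}^d$ by polyhedra on each of which the function is affine; equivalently, a difference of two functions of the form $\max_{1\le i\le n}(\langle b_i,x\rangle+a_i)$ with $a_i\in\mathbb{R}$, $b_i\in\mathbb{R}^d$. A conewise linear function is a piecewise-linear function for which there are a point $p\in\mathbb{R}^d$ and finitely many polyhedral cones with apex $p$ (translates by $p$ of polyhedral cones at the origin) covering $\mathbb{R}^d$ such that the function is affine on each of these cones. *)

(* Defs.v *)
From HB Require Import structures.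
From mathcomp Require Import all_boot all_order all_algebra.
From mathcomp Require Import all_classical all_reals all_analysis.

Set Implicit Arguments.
Unset Strict Implicit.
Unset Printing Implicit Defensive.

Import Order.TTheory GRing.Theory Num.Theory.
Import numFieldNormedType.Exports.

Local Open Scope classical_set_scope.
Local Open Scope ring_scope.

(* Points of R^d are column vectors 'cV[R]_d, whose topology is the entrywise
   (product) one carried by matrices. *)

(* The rows of A and the entries of b are the finitely many defining linear
   inequalities; n = 0 gives the whole space. *)
Definition polyhedron (R : realType) (d : nat) (P : set 'cV[R]_d) : Prop :=
  exists (n : nat) (A : 'M[R]_(n, d)) (b : 'cV[R]_n),
    P = [set x | forall i, (A *m x) i 0 <= b i 0].

Definition polyhedral_cone (R : realType) (d : nat) (C : set 'cV[R]_d) : Prop :=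
  exists (n : nat) (A : 'M[R]_(n, d)),
    C = [set x | forall i, (A *m x) i 0 <= 0].

Definition polyhedral_cone_at (R : realType) (d : nat) (p : 'cV[R]_d)
    (K : set 'cV[R]_d) : Prop :=
  exists2 C : set 'cV[R]_d, polyhedral_cone C & K = [set p + x | x in C].

Definition affine_on (R : realType) (d : nat) (P : set 'cV[R]_d)
    (f : 'cV[R]_d -> R) : Prop :=
  exists (c : 'rV[R]_d) (a : R), forall x, P x -> f x = (c *m x) 0 0 + a.

Definition piecewise_linear (R : realType) (d : nat) (f : 'cV[R]_d -> R) : Prop :=
  continuous f /\
  exists (n : nat) (P : 'I_n -> set 'cV[R]_d),
    [/\ forall i, polyhedron (P i),
        \bigcup_i P i = [set: 'cV[R]_d]
      & forall i, affine_on (P i) f].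

Definition conewise_linear (R : realType) (d : nat) (f : 'cV[R]_d -> R) : Prop :=
  piecewise_linear f /\
  exists (p : 'cV[R]_d) (n : nat) (K : 'I_n -> set 'cV[R]_d),
    [/\ forall i, polyhedral_cone_at p (K i),
        \bigcup_i K i = [set: 'cV[R]_d]
      & forall i, affine_on (K i) f].

(* Main.v *)
(* Let l_1, ..., l_n be the affine pieces of phi.  For all b, x some piece
   satisfies phi b <= l_k b and l_k x <= phi x (one-dimensional argument on the
   segment [x, b]); hence phi is the maximum over b of the minima of the l_k over
   S_b = {k | phi b <= l_k b}, and the min-max form of inclusion-exclusion makes
   phi a signed sum of minima, i.e. of maxima of families of affine functions.
   A maximum of affine functions agreeing at a point p is conewise linear with
   apex p.  Otherwise, since the linear system for p is unsolvable, some
   combination with coefficients of sum 0 is identically 1, and a second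
   inclusion-exclusion writes the maximum as a combination of maxima of fewer
   functions. *)

Require Import Defs.
From HB Require Import structures.
From mathcomp Require Import all_boot all_order all_algebra.
From mathcomp Require Import all_classical all_reals all_analysis.
From mathcomp Require Import ring lra.
Import Order.TTheory GRing.Theory Num.Theory.
Import numFieldNormedType.Exports.
Local Open Scope classical_set_scope.
Local Open Scope ring_scope.

(** * Alternating sums over subsets, and maxima over finite sets *)

Lemma sum_powerset_sign_toggle {R : numDomainType} {I : finType} (J : {set I})
    (i0 : I) (F : {set I} -> R) :
    i0 \in J ->
    (forall T : {set I}, T \subset J -> i0 \notin T -> F (i0 |: T)%SET = F T) ->
  \sum_(T in powerset J) (-1) ^+ #|T| * F T = 0.
Proof.
move=> i0J FU; rewrite (bigID (fun T : {set I} => i0 \in T)) /=.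
(* Each set containing [i0] is matched with the set obtained by removing [i0]; the two terms
   cancel. *)
rewrite (reindex_onto (fun T => i0 |: T)%SET (fun T => T :\ i0)%SET) /=; last first.
  by move=> T /andP[_ i0T]; rewrite finset.setD1K.
rewrite (eq_bigl (fun T => (T \in powerset J) && (i0 \notin T))); last first.
  move=> T; rewrite !powersetE finset.subUset finset.sub1set i0J setU11 andbT /=.
  case: (boolP (i0 \in T)) => i0T; last by rewrite finset.setU1K // eqxx !andbT.
  rewrite andbF; apply/negbTE/nandP; right; apply/eqP => E.
  by move: i0T; rewrite -E !inE eqxx.
rewrite -big_split big1 //= => T /andP[]; rewrite powersetE => TJ i0T.
by rewrite cardsU1 i0T exprS FU // mulN1r mulNr addNr.
Qed.

(** An ordered domain offers no least element to seed the maximum, so the seed is the value at some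
    member of [A]; the empty set gets the default 0. *)
Definition setmax {R : realDomainType} {I : finType} (A : {set I}) (v : I -> R) : R :=
  if [pick i in A] is Some i0 then \big[Order.max/v i0]_(i in A) v i else 0.

Lemma setmax_ge {R : realDomainType} {I : finType} {A : {set I}} (v : I -> R) (i : I) :
  i \in A -> v i <= setmax A v.
Proof.
move=> iA; rewrite /setmax; case: pickP => [i0 _|/(_ i)]; last by rewrite iA.
exact: le_bigmax_cond.
Qed.

Lemma setmax_attained {R : realDomainType} {I : finType} {A : {set I}} (v : I -> R)
    (i : I) : i \in A -> exists2 j, j \in A & setmax A v = v j.
Proof.
move=> iA; rewrite /setmax; case: pickP => [i0 i0A|/(_ i)]; last by rewrite iA.
apply: (big_ind (fun y => exists2 j, j \in A & y = v j)) => [|x y|j jA].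
- by exists i0.
- by move=> [j jA ->] [k kA ->]; case: (leP (v j) (v k)) => _; [exists k|exists j].
- by exists j.
Qed.

Lemma setmax_eq {R : realDomainType} {I : finType} {A : {set I}} (v : I -> R) (i : I) :
  i \in A -> (forall j, j \in A -> v j <= v i) -> setmax A v = v i.
Proof.
move=> iA vle; apply/eqP; rewrite eq_le setmax_ge // andbT.
by have [j jA ->] := setmax_attained v i iA; exact: vle.
Qed.

Lemma setmax_subset {R : realDomainType} {I : finType} {A B : {set I}} (v : I -> R)
    (i : I) :
    i \in A -> A \subset B ->
    (forall j, j \in B -> exists2 k, k \in A & v j <= v k) ->
  setmax B v = setmax A v.
Proof.
move=> iA sAB dom; have [k kA Ek] := setmax_attained v i iA.
rewrite Ek; apply: setmax_eq => [|j jB]; first exact: (fintype.subsetP sAB).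
by have [l lA /le_trans] := dom _ jB; apply; rewrite -Ek setmax_ge.
Qed.

Definition affine_fun {R : realType} {d : nat} (c : 'rV[R]_d) (a : R)
  (x : 'cV[R]_d) : R := (c *m x) 0 0 + a.

Lemma continuous_affine_fun {R : realType} {d : nat} (c : 'rV[R]_d) (a : R) :
  continuous (affine_fun c a).
Proof.
have -> : affine_fun c a = fun x => \sum_j c 0 j * x j 0 + a.
  by apply/funext => x; rewrite /affine_fun mxE.
move=> x; apply: (@cvgD _ R^o _ (nbhs x)); last exact: cvg_cst.
apply: (@cvg_big R^o _ +%R _ _ (fun y => add_continuous y)) => j _.
by apply: cvgM; [exact: cvg_cst|exact: coord_continuous].
Qed.

Lemma continuous_setmax {R : realType} {T : topologicalType} {I : finType}
    (A : {set I}) (f : I -> T -> R) :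
  (forall i, continuous (f i)) -> continuous (fun x => setmax A (fun i => f i x)).
Proof.
move=> fC; rewrite /setmax; case: pickP => [i0 _|_]; last by move=> x; exact: cvg_cst.
rewrite (_ : (fun y => _) =
    fun y => \big[Order.max/f i0 y]_(i <- enum A) f i y); last first.
  by apply/funext => y; rewrite big_enum.
elim: (enum A) => [|i s IHs].
  by under eq_fun do rewrite big_nil; exact: fC.
under eq_fun do rewrite big_cons.
by move=> x; apply: (continuous_max (f := f i)); [exact: fC|exact: IHs].
Qed.

(** * Finite linear combinations of conewise linear functions *)

Definition conewise_span {R : realType} {d : nat} (f : 'cV[R]_d -> R) : Prop :=
  exists (m : nat) (lambda : 'I_m -> R) (g : 'I_m -> 'cV[R]_d -> R),
    (forall i, conewise_linear (g i)) /\
    (forall x, f x = \sum_(i < m) lambda i * g i x).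

Lemma conewise_span1 {R : realType} {d : nat} (f : 'cV[R]_d -> R) :
  conewise_linear f -> conewise_span f.
Proof.
move=> fC; exists 1%N, (fun=> 1), (fun=> f); split=> // x.
by rewrite big_ord1 mul1r.
Qed.

Lemma conewise_spanZ {R : realType} {d : nat} (a : R) (f : 'cV[R]_d -> R) :
  conewise_span f -> conewise_span (fun x => a * f x).
Proof.
move=> [m [la [g [gC fE]]]]; exists m, (fun i => a * la i), g; split=> // x.
by rewrite fE mulr_sumr; apply: eq_bigr => i _; rewrite mulrA.
Qed.

Lemma conewise_spanD {R : realType} {d : nat} (f1 f2 : 'cV[R]_d -> R) :
  conewise_span f1 -> conewise_span f2 -> conewise_span (fun x => f1 x + f2 x).
Proof.
move=> [m [la [g [gC fE]]]] [m' [la' [g' [gC' fE']]]].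
exists (m + m')%N,
  (fun i => match fintype.split i with inl j => la j | inr j => la' j end),
  (fun i => match fintype.split i with inl j => g j | inr j => g' j end).
split=> [i|x]; first by case: fintype.split.
rewrite fE fE' big_split_ord; congr (_ + _); apply: eq_bigr => i _.
  by rewrite (unsplitK (@inl _ 'I_m' i)).
by rewrite (unsplitK (@inr 'I_m _ i)).
Qed.

Lemma conewise_span_sum {R : realType} {d : nat} {I : Type} (r : seq I) (P : pred I)
    (a : I -> R) (f : I -> 'cV[R]_d -> R) :
    (forall i, P i -> conewise_span (f i)) ->
  conewise_span (fun x => \sum_(i <- r | P i) a i * f i x).
Proof.
move=> fS; elim: r => [|i r IHr].
  exists 0%N, (fun _ : 'I_0 => 0), (fun (_ : 'I_0) _ => 0); split=> [[]//|x].
  by rewrite big_nil big_ord0.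
case: (boolP (P i)) => [Pi|/negbTE Pi]; under eq_fun do rewrite big_cons Pi //.
  by apply: conewise_spanD => //; apply/conewise_spanZ/fS.
exact: IHr.
Qed.

Lemma polyhedron_cone_at {R : realType} {d : nat} (p : 'cV[R]_d) (K : set 'cV[R]_d) :
  polyhedral_cone_at p K -> polyhedron K.
Proof.
move=> [C [n [A ->]] ->]; exists n, A, (A *m p); apply/seteqP; split=> x /=.
  by move=> [y yC <-] i; rewrite mulmxDr mxE gerDl yC.
move=> xK; exists (x - p); last by rewrite addrC subrK.
by move=> i; rewrite mulmxBr !mxE subr_le0; have := xK i; rewrite !mxE.
Qed.

Lemma conewise_linearI {R : realType} {d n : nat} (f : 'cV[R]_d -> R)
    (p : 'cV[R]_d) (K : 'I_n -> set 'cV[R]_d) :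
    continuous f -> (forall i, polyhedral_cone_at p (K i)) ->
    \bigcup_i K i = [set: 'cV[R]_d] -> (forall i, affine_on (K i) f) ->
  conewise_linear f.
Proof.
move=> fC KC KT Kf; split; last by exists p, n, K.
by split=> //; exists n, K; split=> // i; exact: polyhedron_cone_at.
Qed.

(** * Maxima of finitely many affine functions *)

(** Fredholm alternative for the system [c k *m p + a k = t], [k \in A], in the unknowns [p] and
    [t]: without a solution, some combination of the equations kills the unknowns but not the
    constants, and is rescaled to 1. *)
Lemma affine_fun_alternative {R : realType} {d n : nat} (A : {set 'I_n})
    (c : 'I_n -> 'rV[R]_d) (a : 'I_n -> R) :
  (exists p, forall i j, i \in A -> j \in A ->
     affine_fun (c i) (a i) p = affine_fun (c j) (a j) p) \/
  (exists mu : 'I_n -> R, \sum_(i in A) mu i = 0 /\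
     forall x, \sum_(i in A) mu i * affine_fun (c i) (a i) x = 1).
Proof.
(* [q i] is the row [(c i, 1)]; the extra column carries the common value [t]. *)
have [q [ql qr]] : exists q : 'I_n -> 'I_(d + 1) -> R,
    (forall i k, q i (lshift 1 k) = c i 0 k) /\ (forall i, q i (rshift d 0) = 1).
  exists (fun i => row_mx (c i) 1%:M 0).
  by split=> [i k|i]; rewrite ?row_mxEl// row_mxEr mxE eqxx.
pose B : 'M[R]_(n, d + 1) := \matrix_(i, k) (if i \in A then q i k else 0).
pose v : 'rV[R]_n := \row_i (if i \in A then a i else 0).
have [/submxP[D vD]|] := boolP (v <= B^T)%MS.
  (* [D] consists of the transpose of [-p] followed by the common value. *)
  left; exists (- (lsubmx D)^T) => i j.
  suff E k : k \in A -> affine_fun (c k) (a k) (- (lsubmx D)^T) = D 0 (rshift d 0).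
    by move=> /E -> /E ->.
  move=> kA; have /matrixP/(_ 0 k) := vD.
  rewrite !mxE kA big_split_ord big_ord1 /= => ak.
  rewrite /affine_fun mulmxN !mxE ak !mxE kA qr mulr1 addrA.
  rewrite [X in X + _](_ : _ = 0) ?add0r// addrC; apply/eqP; rewrite subr_eq0; apply/eqP.
  by apply: eq_bigr => l _; rewrite !mxE kA ql mulrC.
rewrite submxE => /eqP/matrixP vN0; right.
have [j e_neq0] : exists j, (v *m cokermx B^T) 0 j != 0.
  apply/existsP; apply: contra_notT vN0; rewrite negb_exists => /forallP N0 i j.
  by rewrite (ord1 i) [RHS]mxE; apply/eqP; have := N0 j; rewrite negbK.
set e := (v *m cokermx B^T) 0 j in e_neq0.
pose w i := cokermx B^T i j.
have wB k : \sum_(i in A) w i * q i k = 0.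
  have /matrixP/(_ k j) := mulmx_coker B^T.
  rewrite mxE [RHS]mxE => wB; rewrite -[RHS]wB big_mkcond; apply: eq_bigr => i _.
  rewrite [B^T _ _]mxE [B _ _]mxE.
  by case: ifP => _; rewrite ?mul0r// mulrC.
have wa : \sum_(i in A) w i * a i = e.
  rewrite /e mxE big_mkcond; apply: eq_bigr => i _; rewrite [v _ _]mxE.
  by case: ifP => _; rewrite ?mul0r// mulrC.
have w0 : \sum_(i in A) w i = 0.
  by rewrite -[RHS](wB (rshift d 0)); apply: eq_bigr => i _; rewrite qr mulr1.
have wc k : \sum_(i in A) w i * c i 0 k = 0.
  by rewrite -[RHS](wB (lshift 1 k)); apply: eq_bigr => i _; rewrite ql.
exists (fun i => w i / e); split=> [|x]; first by rewrite -mulr_suml w0 mul0r.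
under eq_bigr do rewrite mulrAC /affine_fun mulrDr mxE mulr_sumr.
rewrite -mulr_suml big_split /= wa exchange_big /= big1 ?add0r ?divff// => k _.
under eq_bigr do rewrite mulrA.
by rewrite -mulr_suml wc mul0r.
Qed.

Lemma affine_funD {R : realType} {d : nat} (c : 'rV[R]_d) (a : R) (p y : 'cV[R]_d) :
  affine_fun c a (p + y) = affine_fun c a p + (c *m y) 0 0.
Proof. by rewrite /affine_fun mulmxDr mxE addrAC. Qed.

(** As the pieces agree at [p], their differences are linear in [x - p], so the region where a given
    piece is the largest is a polyhedral cone with apex [p]. *)
Lemma conewise_linear_setmax {R : realType} {d n : nat} (A : {set 'I_n})
    (c : 'I_n -> 'rV[R]_d) (a : 'I_n -> R) (i0 : 'I_n) (p : 'cV[R]_d) :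
    i0 \in A ->
    (forall i j, i \in A -> j \in A ->
       affine_fun (c i) (a i) p = affine_fun (c j) (a j) p) ->
  conewise_linear (fun x => setmax A (fun i => affine_fun (c i) (a i) x)).
Proof.
move=> i0A pE; pose l i := affine_fun (c i) (a i).
pose M (k : 'I_#|A|) : 'M[R]_(n, d) :=
  \matrix_(j, s) (if j \in A then (c j - c (enum_val k)) 0 s else 0).
pose K k := [set p + y | y in [set y | forall j, (M k *m y) j 0 <= 0]].
have KP k x : K k x <-> forall j, j \in A -> l j x <= l (enum_val k) x.
  have kA : enum_val k \in A by exact: enum_valP.
  have E y j : j \in A ->
      (M k *m y) j 0 = l j (p + y) - l (enum_val k) (p + y).
    move=> jA; rewrite /l !affine_funD (pE j (enum_val k)) // opprD addrACA subrr add0r.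
    rewrite !mxE -sumrB; apply: eq_bigr => s _.
    by rewrite mxE jA !mxE mulrBl.
  split=> [[y yK <-] j jA|xK]; first by rewrite -subr_le0 -E.
  exists (x - p); last by rewrite addrC subrK.
  move=> j; have [jA|jA] := boolP (j \in A).
    by rewrite E // [p + _]addrC subrK subr_le0 xK.
  by rewrite mxE big1 // => s _; rewrite mxE (negbTE jA) mul0r.
apply: (conewise_linearI _ p K).
- by apply: continuous_setmax => i; exact: continuous_affine_fun.
- by move=> k; eexists; [exists n, (M k)|].
- apply/seteqP; split=> // x _.
  have [i iA Ei] := setmax_attained (fun i => l i x) i0 i0A.
  exists (enum_rank_in iA i) => //; apply/KP => j jA.
  by rewrite enum_rankK_in // -Ei setmax_ge.
- move=> k; exists (c (enum_val k)), (a (enum_val k)) => x /KP xK.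
  by apply: setmax_eq => //; exact: enum_valP.
Qed.

(* With mu from affine_fun_alternative and J = {i in A | mu i < 0}, at each point
   some piece outside J is at least some piece in J.  Hence, for T a subset of J,
   the max over A \ T is unchanged by toggling that element of J in T. *)
Lemma conewise_span_setmax {R : realType} {d n : nat} (A : {set 'I_n})
    (c : 'I_n -> 'rV[R]_d) (a : 'I_n -> R) (i0 : 'I_n) :
    i0 \in A ->
  conewise_span (fun x => setmax A (fun i => affine_fun (c i) (a i) x)).
Proof.
have [m leAm] := ubnP #|A|; elim: m => // m IHm in A i0 leAm *.
move=> i0A; have [[p pE]|[mu [mu0 mu1]]] := affine_fun_alternative A c a.
  by apply: conewise_span1; exact: (conewise_linear_setmax _ _ _ _ p i0A).
pose l x i := affine_fun (c i) (a i) x.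
pose J := [set i in A | mu i < 0]%SET.
(* As [mu] sums to 0 over [A], the sum of [mu i * (l x i - t)] is 1 for every [t], so some term is
   positive. *)
have contra x t : (forall i, i \in A -> mu i * (l x i - t) <= 0) -> False.
  move=> le0; have : \sum_(i in A) mu i * (l x i - t) <= 0 by exact: sumr_le0.
  under eq_bigr do rewrite mulrBr.
  by rewrite sumrB mu1 -mulr_suml mu0 mul0r subr0 ler10.
have JP x : exists j k, [/\ j \in J, k \in A :\: J & l x j <= l x k].
  have [j jJ jmin] : exists2 j, j \in J & forall i, i \in J -> l x j <= l x i.
    have [J0|[j jJ]] := finset.set_0Vmem J; last first.
      have [k kJ Ek] := setmax_attained (fun i => - l x i) j jJ.
      exists k => // i iJ; rewrite -lerN2 -Ek.
      exact: (setmax_ge (fun i => - l x i)).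
    (* If [J] is empty, all weights on [A] are nonnegative and the maximum serves as [t]. *)
    exfalso; apply: (contra x (setmax A (l x))) => i iA.
    rewrite mulr_ge0_le0 //; last by rewrite subr_le0 setmax_ge.
    rewrite leNgt; apply/negP => mui.
    by have := finset.in_set0 i; rewrite -J0 !inE iA mui.
  have [/existsP[k /andP[kAJ jk]]|nk] :=
      boolP [exists k, (k \in A :\: J)%SET && (l x j <= l x k)].
    by exists j, k.
  (* Otherwise [t = l x j], the minimum over [J], makes every term nonpositive. *)
  exfalso; apply: (contra x (l x j)) => i iA.
  have [mui|mui] := ltP (mu i) 0.
    by rewrite mulr_le0_ge0 ?(ltW mui)// subr_ge0 jmin // !inE iA.
  rewrite mulr_ge0_le0 // subr_le0 leNgt; apply/negP => ji.
  move/negP: nk; apply; apply/existsP; exists i.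
  by rewrite (ltW ji) !inE iA -leNgt mui.
pose F (T : {set 'I_n}) x := setmax (A :\: T)%SET (l x).
have F0 x : \sum_(T in powerset J) (-1) ^+ #|T| * F T x = 0.
  have [j [k [jJ kAJ jk]]] := JP x.
  have jA : j \in A by move: jJ; rewrite inE => /andP[].
  have [kJ kA] : k \notin J /\ k \in A by move: kAJ; rewrite 2!inE => /andP[].
  apply: (sum_powerset_sign_toggle J j) => // T TJ jT.
  have kN : k \in (A :\: (j |: T))%SET.
    rewrite !inE kA andbT negb_or; apply/andP; split.
      by apply: contraNneq kJ => ->.
    by apply: contraNN kJ => /(fintype.subsetP TJ).
  symmetry; apply: (setmax_subset _ k) => //.
    by apply: finset.setDS; exact: finset.subsetUr.
  move=> i; rewrite inE => /andP[iT iA].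
  have [->|ij] := eqVneq i j; first by exists k.
  by exists i => //; rewrite !inE (negbTE ij) iT.
(* The point 0 is arbitrary; [k] lies outside [J], which keeps every [A :\: T] below nonempty. *)
have [j [k [jJ kAJ _]]] := JP 0.
have -> : (fun x => setmax A (l x)) = fun x =>
    -1 * \sum_(T in powerset J | T != finset.set0) (-1) ^+ #|T| * F T x.
  apply/funext => x; apply/eqP; rewrite mulN1r -addr_eq0; apply/eqP.
  rewrite -[RHS](F0 x) [RHS](bigD1 finset.set0) ?powersetE ?finset.sub0set //=.
  by rewrite cards0 expr0 mul1r /F finset.setD0.
apply: conewise_spanZ; apply: conewise_span_sum => T; rewrite powersetE => /andP[TJ T0].
have kAT : k \in (A :\: T)%SET.
  by apply: (fintype.subsetP (finset.setDS A TJ)).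
apply: (IHm _ k) => //; rewrite -ltnS; apply: leq_trans leAm; rewrite ltnS.
have /finset.set0Pn[t tT] := T0.
have := fintype.subsetP TJ _ tT; rewrite inE => /andP[tA _].
apply: proper_card; apply/fintype.properP; split; first exact: finset.subsetDl.
by exists t => //; rewrite inE tT.
Qed.

(** * Continuous selections of affine functions along a segment *)

(** By continuity and finiteness, the pieces inactive at [s] all stay inactive nearby, so a piece
    active at [t] near [s] is active at [s] too. *)
Lemma near_common_selection {R : realType} {T : topologicalType} {n : nat} (f : T -> R)
    (l : 'I_n -> T -> R) :
    continuous f -> (forall k, continuous (l k)) -> (forall x, exists k, f x = l k x) ->
  forall s, \forall t \near s, exists k, f s = l k s /\ f t = l k t.
Proof.
move=> fC lC fl s.
have : \forall t \near s, forall k, f s <> l k s -> f t <> l k t.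
  apply: filter_forall => k; have [E|fls] := pselect (f s = l k s).
    by apply: nearW => t /(_ E).
  have : f t - l k t @[t --> s] --> f s - l k s by apply: cvgB; [exact: fC|exact: lC].
  have fls0 : f s - l k s != 0 by rewrite subr_eq0; exact/eqP.
  move=> /cvgr_neq0 /(_ fls0); apply: filterS => t ft0 _ E.
  by move: ft0; rewrite E subrr eqxx.
apply: filterS => t fl0; have [k ftk] := fl t; exists k; split=> //.
by apply: contrapT => /fl0.
Qed.

(* Let s be the last point before 1 where h is nonpositive.  If every piece with
   u k <= 0 had u k + v k < 0, every piece active at a nonpositive value of h
   would stay nonpositive up to 1, so h could not become positive after s. *)
Lemma selection_above_chord {R : realType} {n : nat} (h : R -> R) (u v : 'I_n -> R) :
    continuous h -> (forall t, exists k, h t = u k + t * v k) -> h 0 = 0 -> h 1 = 0 ->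
  exists k, u k <= 0 /\ 0 <= u k + v k.
Proof.
move=> hC hl h0 h1; apply: contrapT => noP.
have N k : u k <= 0 -> u k + v k < 0.
  by move=> uk; rewrite ltNge; apply/negP => uvk; apply: noP; exists k.
(* A piece positive at 0 and nonnegative at 1 is positive on [[0, 1)], hence not active where
   [h t <= 0]. *)
have D (t : R) k : 0 <= t -> t < 1 -> h t <= 0 -> h t = u k + t * v k -> u k + v k < 0.
  move=> t0 t1 ht htk; rewrite ltNge; apply/negP => uv.
  have uk : 0 < u k by rewrite ltNge; apply/negP => /N; rewrite ltNge uv.
  by move: ht; rewrite htk leNgt => /negP; apply; nra.
have lC k : continuous (fun t : R => u k + t * v k).
  by move=> t; apply: cvgD; [|apply: cvgM; [exact: cvg_id|]]; exact: cvg_cst.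
have near s := near_common_selection h _ hC lC hl s.
pose S := [set t : R | [/\ 0 <= t, t < 1 & h t <= 0]].
have S0 : S 0 by split; rewrite ?h0.
have Sub : has_ubound S by exists 1 => t [_ /ltW].
have Ssup : has_sup S by split; [exists 0|].
set s := sup S; have s0 : 0 <= s by exact: ub_le_sup.
have s1 : s <= 1 by apply: ge_sup => [|t [_ /ltW]//]; exists 0.
have /nbhs_ballP[e /= e0 eP] := near s.
(* A piece active at [s] and at a nearby [t] in [S] is nonpositive at [t] and negative at 1, hence
   nonpositive at [s]; [s = 1] would contradict [h 1 = 0]. *)
have [s_lt1 hs] : s < 1 /\ h s <= 0.
  have [t St st] := sup_adherent e0 Ssup; have ts : t <= s by exact: ub_le_sup.
  have [k [hsk htk]] : exists k, h s = u k + s * v k /\ h t = u k + t * v k.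
    by apply: eP; rewrite /ball /= ger0_norm ?subr_ge0//; rewrite -/s in st; lra.
  case: St => t0 t1 ht; have uv := D t k t0 t1 ht htk.
  have hs : h s <= 0 by rewrite hsk; rewrite htk in ht; nra.
  split=> //; rewrite lt_neqAle s1 andbT; apply/eqP => E.
  by move: uv; rewrite E h1 mul1r in hsk; rewrite -hsk ltxx.
(* A step to the right that stays in the ball around [s] and below 1. *)
pose m := Num.min e (1 - s) / 2.
have m0 : 0 < m by rewrite divr_gt0 // lt_min e0 subr_gt0.
have me : m < e by rewrite ltr_pdivrMr // gt_min mulr_natr mulr2n ltrDl e0.
have ms : s + m < 1.
  have : Num.min e (1 - s) <= 1 - s by rewrite ge_min lexx orbT.
  by rewrite /m; lra.
have [k [hsk htk]] : exists k, h s = u k + s * v k /\ h (s + m) = u k + (s + m) * v k.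
  by apply: eP; rewrite /ball /= distrC addrAC subrr add0r gtr0_norm.
have uv := D s k s0 s_lt1 hs hsk.
have : S (s + m).
  split=> //; first by lra.
  by rewrite htk; rewrite hsk in hs; nra.
by move=> /(ub_le_sup Sub); rewrite -/s; lra.
Qed.

(** On the segment from [x] to [b], subtracting the chord of [phi] from [phi] and from every piece
    reduces the claim to [selection_above_chord]. *)
Lemma selection_separates {R : realType} {d n : nat} (phi : 'cV[R]_d -> R)
    (c : 'I_n -> 'rV[R]_d) (a : 'I_n -> R) (b x : 'cV[R]_d) :
    continuous phi -> (forall y, exists k, phi y = affine_fun (c k) (a k) y) ->
  exists k, phi b <= affine_fun (c k) (a k) b /\ affine_fun (c k) (a k) x <= phi x.
Proof.
move=> phiC phil; pose l k := affine_fun (c k) (a k).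
pose g (t : R) := x + t *: (b - x).
have lg k t : l k (g t) = l k x + t * (l k b - l k x).
  rewrite /l /g affine_funD -scalemxAr mxE; congr (_ + _ * _).
  by rewrite mulmxBr /affine_fun; move: (c k *m b) (c k *m x) => *; rewrite !mxE; ring.
have gC : continuous g.
  move=> t; apply: cvgD; first exact: cvg_cst.
  by apply: cvgZr_tmp; exact: cvg_id.
pose h t := phi (g t) - (phi x + t * (phi b - phi x)).
have hC : continuous h.
  move=> t; apply: cvgB.
    by apply: (continuous_comp (gC t)); exact: phiC.
  by apply: cvgD; [exact: cvg_cst|apply: cvgM; [exact: cvg_id|exact: cvg_cst]].
have [t|||k [uk uvk]] := selection_above_chord h (fun k => l k x - phi x)
    (fun k => (l k b - phi b) - (l k x - phi x)) hC.
- have [k phik] := phil (g t); exists k; rewrite /h phik -/(l k) lg; ring.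
- by rewrite /h /g scale0r addr0 mul0r addr0 subrr.
- by rewrite /h /g scale1r mul1r !GRing.subrKC subrr.
by exists k; split; rewrite -/(l k); lra.
Qed.

(** * Min-max inclusion-exclusion for a piecewise-linear function *)

Theorem theorem3 (R : realType) (d : nat) (phi : 'cV[R]_d -> R)
    (hphi : piecewise_linear phi) :
  exists (m : nat) (lambda : 'I_m -> R) (g : 'I_m -> 'cV[R]_d -> R),
    (forall i, conewise_linear (g i)) /\
    (forall x, phi x = \sum_(i < m) lambda i * g i x).
Proof.
case: hphi => phiC [n [P [_ PT /(_ _)/cid-/all_sig[c ca]]]].
have /all_sig[a phia] := fun i => cid (ca i).
pose l x k := affine_fun (c k) (a k) x.
have phil x : exists k, phi x = l x k.
  have : [set: 'cV[R]_d] x by [].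
  by rewrite -PT => -[k _ /phia Ek]; exists k.
pose S x := [set k | phi x <= l x k]%SET.
(* Finite although [x] ranges over all points: each [S x] is a subset of ['I_n]. *)
pose J := [set B | `[< exists x, B = S x >]]%SET.
pose C (T : {set {set 'I_n}}) := (\bigcup_(B in T) B)%SET.
have CN0 (T : {set {set 'I_n}}) : T \subset J -> T != finset.set0 ->
    exists x, S x \subset C T.
  move=> /fintype.subsetP TJ /finset.set0Pn[B BT].
  have := TJ _ BT; rewrite inE => /asboolP[x Bx]; exists x; rewrite -Bx.
  exact: finset.bigcup_sup.
(* [- setmax (C T) (- l)] is the minimum of the pieces indexed by [C T]. *)
pose F (T : {set {set 'I_n}}) x :=
  if T == finset.set0 then phi x else - setmax (C T) (fun k => - l x k).
(* [S x] is toggled. The minimum over [S x] is [phi x], the value of [F] at the empty family; for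
   nonempty [T], [selection_separates] finds in [C T] a piece at most [phi x] at [x], so adding
   [S x] leaves the minimum unchanged. *)
have F0 x : \sum_(T in powerset J) (-1) ^+ #|T| * F T x = 0.
  have SJ : S x \in J by rewrite inE; apply/asboolP; exists x.
  have [k0 Ek0] := phil x; have k0S : k0 \in S x by rewrite inE Ek0.
  apply: (sum_powerset_sign_toggle J (S x)) => // T TJ ST.
  have UC : C (S x |: T)%SET = (S x :|: C T)%SET.
    by rewrite /C finset.bigcup_setU finset.big_set1.
  have -> : F (S x |: T)%SET x = - setmax (S x :|: C T)%SET (fun k => - l x k).
    rewrite /F -UC ifN //; apply/finset.set0Pn; exists (S x); exact: setU11.
  rewrite /F; case: ifPn => [/eqP ->|T0].
    rewrite /C finset.big_set0 finset.setU0 (setmax_eq _ k0) ?opprK//.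
    by move=> j; rewrite inE lerN2 -Ek0.
  congr (- _); have [b Sb] := CN0 T TJ T0.
  have [k [kb kx]] := selection_separates phi c a b x phiC phil.
  have kC : k \in C T by apply: (fintype.subsetP Sb); rewrite inE.
  apply: (setmax_subset _ k) => //; first exact: finset.subsetUr.
  move=> j; rewrite !inE => /orP[phij|jC]; last by exists j.
  by exists k => //; rewrite lerN2; exact: le_trans phij.
have phiE x : phi x =
    -1 * \sum_(T in powerset J | T != finset.set0) (-1) ^+ #|T| * F T x.
  apply/eqP; rewrite mulN1r -addr_eq0; apply/eqP.
  rewrite -[RHS](F0 x) [RHS](bigD1 finset.set0) ?powersetE ?finset.sub0set //=.
  by rewrite cards0 expr0 mul1r /F eqxx.
change (conewise_span phi); rewrite (funext phiE).
apply: conewise_spanZ; apply: conewise_span_sum => T; rewrite powersetE => /andP[TJ T0].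
have [x Sx] := CN0 T TJ T0; have [k Ek] := phil x.
have kC : k \in C T by apply: (fintype.subsetP Sx); rewrite inE Ek.
rewrite (_ : F T = fun y => -1 *
    setmax (C T) (fun k => affine_fun (- c k) (- a k) y)); last first.
  apply/funext => y; rewrite /F (negbTE T0) mulN1r; congr (- setmax _ _).
  by apply/funext => j; rewrite /l /affine_fun mulNmx; move: (c j *m y) => z; rewrite mxE opprD.
by apply: conewise_spanZ; exact: (conewise_span_setmax _ _ _ k).
Qed.
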